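(* Let $f : \mathbb{R} \to \mathbb{R}$ be continuous and let $F(x) = \int_0^x f(t)\,dt$. Assume that the limits $F(\infty) = \lim_{x \to \infty} F(x)$ and $F(-\infty) = \lim_{x \to -\infty} F(x)$ exist and are finite, and that $F(-\infty) < F(x) < F(\infty)$ for all $x \in \mathbb{R}$. Let $e : [0,\pi] \to \mathbb{R}$ be continuous, and set $A = \int_0^{\pi} e(t) \sin t \, dt$. If the Dirichlet problem $$x'' - \frac{d}{dt} F(x(t)) + x = e(t), \quad 0 < t < \pi, \qquad x(0) = x(\pi) = 0,$$ has a solution $x = x(t)$, then $$|A| < F(\infty) - F(-\infty).$$
   Context: A solution is a function $x \in C^2[0,\pi]$ satisfying the differential equation on $(0,\pi)$ and the boundary conditions. *)

(* Defs.v *)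
From Stdlib Require Import Reals.
From Coquelicot Require Import Coquelicot.
Open Scope R_scope.

(* A function on the closed interval from 0 to PI is a total function on R of
   which only the values on that interval matter: continuity and derivatives
   are relative to I0PI, so they are one-sided at the endpoints. *)
Definition I0PI (t : R) : Prop := 0 <= t <= PI.

Definition C2_on (D : R -> Prop) (x : R -> R) : Prop :=
  exists x1 x2 : R -> R,
    (forall t, D t -> D_in x x1 D t) /\
    (forall t, D t -> D_in x1 x2 D t) /\
    continuous_on D x2.

Definition antideriv0 (f : R -> R) (x : R) : R := RInt f 0 x.

(* Derive and Derive_n are total, but here they are taken at interior points,
   where the derivatives exist whenever f is continuous and x is C2 on I0PI. *)
Definition is_solution (f e x : R -> R) : Prop :=
  C2_on I0PI x /\
  (forall t, 0 < t < PI ->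
     Derive_n x 2 t - Derive (fun s => antideriv0 f (x s)) t + x t = e t) /\
  x 0 = 0 /\ x PI = 0.

(* Main.v *)
Require Import Defs.
From Stdlib Require Import Reals Lra.
From Coquelicot Require Import Coquelicot.
Open Scope R_scope.

(** Multiply the equation by [sin] and integrate over [0, PI].  Since [sin] solves
    [u'' + u = 0] and all boundary terms vanish, only the damping term survives and
    [A] is the integral of [F (x t) * cos t].  As [cos] changes sign exactly at [PI / 2], with
    integral [1] before and [-1] after, the strict bounds on [F] give the strict
    bound on [A]. *)

(** Composing with [clamp] turns data known only on an interval into total functions that are
    continuous on all of R and unchanged inside, so one-sided behaviour at the endpoints needs no
    separate treatment. *)
Definition clamp (a b t : R) : R := Rmax a (Rmin t b).

Lemma clamp_id (a b t : R) : a <= t <= b -> clamp a b t = t.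
Proof.
  intros Ht; unfold clamp.
  rewrite Rmin_left by lra; apply Rmax_right; lra.
Qed.

Lemma clamp_range (a b t : R) : a <= b -> a <= clamp a b t <= b.
Proof.
  intros Hab; unfold clamp; split; [apply Rmax_l|].
  apply Rmax_lub; [lra|apply Rmin_r].
Qed.

Lemma clamp_dist (a b s t : R) : Rabs (clamp a b s - clamp a b t) <= Rabs (s - t).
Proof.
  unfold clamp, Rmin, Rmax.
  destruct (Rle_dec s b), (Rle_dec t b);
    repeat match goal with |- context [Rle_dec ?u ?v] => destruct (Rle_dec u v) end;
    unfold Rabs;
    repeat match goal with |- context [Rcase_abs ?u] => destruct (Rcase_abs u) end; lra.
Qed.

(** The clamp is 1-Lipschitz with values in the interval, so it sends a neighbourhood of [t] into a
    relative neighbourhood of [clamp a b t], where relative continuity of [g] suffices. *)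
Lemma continuous_clamp (a b : R) (g : R -> R) (t : R) :
  a <= b -> continuous_on (fun u => a <= u <= b) g ->
  continuous (fun s => g (clamp a b s)) t.
Proof.
  intros Hab Hg.
  apply (filterlim_comp _ _ _ (clamp a b) g (locally t)
    (within (fun u => a <= u <= b) (locally (clamp a b t)))).
  - intros P [eps HP]; exists eps; intros s Hs.
    apply HP; [|now apply clamp_range].
    change (Rabs (clamp a b s - clamp a b t) < eps).
    eapply Rle_lt_trans; [apply clamp_dist|exact Hs].
  - apply Hg, clamp_range, Hab.
Qed.

(** At an interior point small increments stay in [D], so the relative difference quotient is the
    ordinary one. *)
Lemma is_derive_D_in (D : R -> Prop) (g dg : R -> R) (t : R) :
  locally t D -> D_in g dg D t -> is_derive g t (dg t).
Proof.
  intros [d Hd] Hg; apply is_derive_Reals; intros eps Heps.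
  destruct (Hg eps Heps) as [alp [Halp H]].
  assert (Hm : 0 < Rmin d alp) by (apply Rmin_pos; [apply cond_pos|exact Halp]).
  exists (mkposreal _ Hm); intros h Hh Hlt; simpl in Hlt.
  pose proof (Rmin_l d alp); pose proof (Rmin_r d alp).
  specialize (H (t + h)); simpl in H; unfold Rdist in H.
  replace (t + h - t) with h in H by ring.
  apply H; split; [split|lra].
  - apply Hd.
    change (Rabs (t + h - t) < d).
    replace (t + h - t) with h by ring; lra.
  - lra.
Qed.

Lemma continuous_on_D_in (D : R -> Prop) (g dg : R -> R) :
  (forall t, D t -> D_in g dg D t) -> continuous_on D g.
Proof.
  intros Hg t Ht.
  assert (Hc := cont_deriv _ _ _ _ (Hg t Ht)).
  intros P [eps HP].
  destruct (Hc eps (cond_pos eps)) as [alp [Halp H]].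
  exists (mkposreal alp Halp); intros s Hs HsD; apply HP.
  (* The limit behind [D_in] is punctured at [t], while the filter in [continuous_on] is not. *)
  destruct (Req_dec t s) as [<-|Hne].
  - apply ball_center.
  - apply (H s); split; [now split|exact Hs].
Qed.

Lemma locally_open_interval (a b t : R) :
  a < t < b -> locally t (fun s => a < s < b).
Proof.
  intros Ht; apply (open_and (fun s => a < s) (fun s => s < b)); auto.
  - apply open_gt.
  - apply open_lt.
Qed.

Lemma ex_RInt_everywhere_continuous (g : R -> R) (a b : R) :
  (forall t, continuous g t) -> ex_RInt g a b.
Proof.
  intros Hg; apply (ex_RInt_continuous (V := R_CompleteNormedModule)); auto.
Qed.

(** Clamped functions may have corners at the endpoints, so differentiability is asked only inside.
    The difference of [G] and the primitive of [g] is continuous with zero derivative inside, and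
    the mean value theorem equates its end values. *)
Lemma RInt_of_interior_derive (G g : R -> R) (a b : R) :
  a < b ->
  (forall t, continuous G t) -> (forall t, continuous g t) ->
  (forall t, a < t < b -> is_derive G t (g t)) ->
  RInt g a b = G b - G a.
Proof.
  intros Hab HG Hg Hd.
  assert (HI : forall t, is_derive (RInt g a) t (g t)).
  { intros t; apply (is_derive_RInt g _ a); [|apply Hg].
    apply filter_forall; intros s.
    apply (RInt_correct (V := R_CompleteNormedModule)), ex_RInt_everywhere_continuous, Hg. }
  destruct (MVT_gen (fun t => G t - RInt g a t) a b (fun _ => 0)) as [c [_ Hc]].
  - rewrite Rmin_left, Rmax_right by lra; intros t Ht.
    replace 0 with (g t - g t) by ring.
    apply (is_derive_minus G (RInt g a)); auto.
  - intros t _; apply continuity_pt_filterlim.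
    apply (continuous_minus G (RInt g a)); [apply HG|].
    apply ex_derive_continuous; eexists; apply HI.
  - rewrite RInt_point in Hc.
    change (@zero R_CompleteNormedModule) with 0 in Hc; lra.
Qed.

Lemma is_derive_antideriv0 (f : R -> R) (s : R) :
  (forall u, continuous f u) -> is_derive (antideriv0 f) s (f s).
Proof.
  intros Hf; apply (is_derive_RInt f _ 0); [|apply Hf].
  apply filter_forall; intros u.
  apply (RInt_correct (V := R_CompleteNormedModule)), ex_RInt_everywhere_continuous, Hf.
Qed.

Lemma continuous_antideriv0 (f : R -> R) (s : R) :
  (forall u, continuous f u) -> continuous (antideriv0 f) s.
Proof.
  intros Hf; apply (ex_derive_continuous (antideriv0 f)).
  exists (f s); now apply is_derive_antideriv0.
Qed.

Lemma is_RInt_cos (a b : R) : is_RInt cos a b (sin b - sin a).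
Proof.
  apply (is_RInt_derive sin cos); intros t _.
  - apply is_derive_sin.
  - apply continuous_cos.
Qed.

Lemma RInt_mult_cos_lt (phi : R -> R) (m M : R) :
  (forall t, continuous phi t) -> (forall t, m < phi t < M) ->
  RInt (fun t => phi t * cos t) 0 PI < M - m.
Proof.
  intros Hc Hb.
  pose proof PI_RGT_0 as Hpi.
  (* The constant [k] will be [M] on the first half of the interval and [m] on the second. *)
  assert (Hcc : forall k t, continuous (fun t => (k - phi t) * cos t) t).
  { intros k t; apply (continuous_mult (fun t => k - phi t) cos).
    - apply (continuous_minus (fun _ => k) phi); [apply continuous_const|apply Hc].
    - apply continuous_cos. }
  assert (Hpc : forall a b, ex_RInt (fun t => phi t * cos t) a b).
  { intros a b; apply ex_RInt_everywhere_continuous; intros t.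
    apply (continuous_mult phi cos); [apply Hc|apply continuous_cos]. }
  assert (Heq : forall k a b, RInt (fun t => (k - phi t) * cos t) a b
            = k * (sin b - sin a) - RInt (fun t => phi t * cos t) a b).
  { intros k a b; apply is_RInt_unique.
    apply (is_RInt_ext (fun t => minus (scal k (cos t)) (phi t * cos t))).
    { intros t _; unfold minus, plus, opp, scal; simpl; unfold mult; simpl; ring. }
    apply (is_RInt_minus (V := R_NormedModule)).
    - apply (is_RInt_scal (V := R_NormedModule)), is_RInt_cos.
    - apply (RInt_correct (V := R_CompleteNormedModule)), Hpc. }
  (* Positivity is needed only on the open interval, so the zero of [cos] at [PI / 2] does no
     harm. *)
  assert (H1 : 0 < RInt (fun t => (M - phi t) * cos t) 0 (PI / 2)).
  { apply RInt_gt_0; [lra| |auto].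
    intros t Ht; apply Rmult_lt_0_compat; [specialize (Hb t); lra|].
    apply cos_gt_0; lra. }
  assert (H2 : 0 < RInt (fun t => (m - phi t) * cos t) (PI / 2) PI).
  { apply RInt_gt_0; [lra| |auto].
    intros t Ht.
    assert (cos t < 0) by (apply cos_lt_0; lra).
    specialize (Hb t); nra. }
  (* The two inequalities now bound the integral over the first half by [M] and over the second half
     by [- m]. *)
  rewrite Heq in H1, H2.
  rewrite sin_PI2, sin_0 in H1; rewrite sin_PI2, sin_PI in H2.
  rewrite <- (RInt_Chasles (V := R_CompleteNormedModule) _ 0 (PI / 2) PI) by apply Hpc.
  unfold plus; simpl; lra.
Qed.

(** The lower bound is the upper bound for [- phi], whose values lie between [- M] and [- m], a gap
    of the same length. *)
Lemma Rabs_RInt_mult_cos_lt (phi : R -> R) (m M : R) :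
  (forall t, continuous phi t) -> (forall t, m < phi t < M) ->
  Rabs (RInt (fun t => phi t * cos t) 0 PI) < M - m.
Proof.
  intros Hc Hb; apply Rabs_def1; [now apply RInt_mult_cos_lt|].
  assert (H : RInt (fun t => - phi t * cos t) 0 PI < - m - - M).
  { apply (RInt_mult_cos_lt (fun t => - phi t)).
    - intros t; apply (continuous_opp phi), Hc.
    - intros t; specialize (Hb t); lra. }
  rewrite (RInt_ext _ (fun t => opp (phi t * cos t))) in H
    by (intros t _; unfold opp; simpl; ring).
  rewrite (RInt_opp (V := R_CompleteNormedModule)) in H.
  - unfold opp in H; simpl in H; lra.
  - apply ex_RInt_everywhere_continuous; intros t.
    apply (continuous_mult phi cos); [apply Hc|apply continuous_cos].
Qed.

Lemma RInt_forcing_sin (f e x : R -> R) :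
  (forall s, continuous f s) -> continuous_on I0PI e -> is_solution f e x ->
  RInt (fun t => e t * sin t) 0 PI
  = RInt (fun t => antideriv0 f (x (clamp 0 PI t)) * cos t) 0 PI.
Proof.
  intros Hf He [[x1 [x2 [Hx [Hx1 _]]]] [Heq [Hx0 HxPI]]].
  pose proof PI_RGT_0 as Hpi.
  set (c := clamp 0 PI).
  assert (Hcx : forall t, continuous (fun s => x (c s)) t).
  { intros t; apply continuous_clamp; [lra|]; exact (continuous_on_D_in _ _ _ Hx). }
  assert (Hcx1 : forall t, continuous (fun s => x1 (c s)) t).
  { intros t; apply continuous_clamp; [lra|]; exact (continuous_on_D_in _ _ _ Hx1). }
  assert (Hce : forall t, continuous (fun s => e (c s)) t).
  { intros t; apply continuous_clamp; [lra|exact He]. }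
  assert (HcF : forall t, continuous (fun s => antideriv0 f (x (c s))) t).
  { intros t; apply (continuous_comp (fun s => x (c s)) (antideriv0 f)); [apply Hcx|].
    now apply continuous_antideriv0. }
  assert (HFcos : forall t, continuous (fun s => antideriv0 f (x (c s)) * cos s) t).
  { intros t; apply (continuous_mult (fun s => antideriv0 f (x (c s))) cos);
      [apply HcF|apply continuous_cos]. }
  assert (Hesin : forall t, continuous (fun s => e (c s) * sin s) t).
  { intros t; apply (continuous_mult (fun s => e (c s)) sin);
      [apply Hce|apply continuous_sin]. }
  assert (HI : forall t, 0 < t < PI -> locally t I0PI).
  { intros t Ht; apply (filter_imp (fun s => 0 < s < PI)).
    - intros s Hs; unfold I0PI; lra.
    - now apply locally_open_interval. }
  assert (Hdx : forall t, 0 < t < PI -> is_derive x t (x1 t)).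
  { intros t Ht; apply (is_derive_D_in I0PI); [auto|apply Hx; unfold I0PI; lra]. }
  assert (Hdx1 : forall t, 0 < t < PI -> is_derive x1 t (x2 t)).
  { intros t Ht; apply (is_derive_D_in I0PI); [auto|apply Hx1; unfold I0PI; lra]. }
  set (g := fun t => e (c t) * sin t - antideriv0 f (x (c t)) * cos t).
  (* [G] collects the boundary terms of the integrations by parts. Inside the interval the equation
     makes [g] its derivative, and [G] vanishes at both ends because [sin] and [x] do. *)
  set (G := fun t => (x1 (c t) - antideriv0 f (x (c t))) * sin t - x (c t) * cos t).
  assert (Hz : 0 = RInt g 0 PI).
  { rewrite (RInt_of_interior_derive G g); [|lra| | |].
    - unfold G, c; rewrite !clamp_id, Hx0, HxPI, sin_0, sin_PI by lra; ring.
    - intros t; apply (continuous_minus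
        (fun t => (x1 (c t) - antideriv0 f (x (c t))) * sin t) (fun t => x (c t) * cos t)).
      + apply (continuous_mult (fun t => x1 (c t) - antideriv0 f (x (c t))) sin);
          [|apply continuous_sin].
        apply (continuous_minus (fun t => x1 (c t)) (fun t => antideriv0 f (x (c t)))); auto.
      + apply (continuous_mult (fun t => x (c t)) cos); [apply Hcx|apply continuous_cos].
    - intros t; apply (continuous_minus (fun s => e (c s) * sin s)
        (fun s => antideriv0 f (x (c s)) * cos s)); auto.
    - intros t Ht.
      apply (is_derive_ext_loc
        (fun t => (x1 t - antideriv0 f (x t)) * sin t - x t * cos t)).
      { apply (filter_imp (fun s => 0 < s < PI)); [|now apply locally_open_interval].
        intros s Hs; unfold G, c; rewrite clamp_id by lra; reflexivity. }
      assert (HdF := is_derive_antideriv0 f (x t) Hf).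
      assert (HDFx : Derive (fun s => antideriv0 f (x s)) t = x1 t * f (x t)).
      { apply is_derive_unique.
        exact (is_derive_comp (antideriv0 f) x t _ _ HdF (Hdx t Ht)). }
      (* [Derive x] is known to equal [x1] only inside the interval, which is enough since
         differentiating again is local. *)
      assert (H2 : Derive_n x 2 t = x2 t).
      { simpl; rewrite (Derive_ext_loc _ x1); [now apply is_derive_unique, Hdx1|].
        apply (filter_imp (fun s => 0 < s < PI)); [|now apply locally_open_interval].
        intros s Hs; now apply is_derive_unique, Hdx. }
      assert (Hg : g t = (x2 t - x1 t * f (x t) + x t) * sin t - antideriv0 f (x t) * cos t).
      { unfold g, c; rewrite clamp_id, <- (Heq t Ht), H2, HDFx by lra; reflexivity. }
      rewrite Hg; auto_derive.
      + repeat split; eexists; [now apply Hdx1|exact HdF|now apply Hdx|now apply Hdx].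
      (* With the abstract derivatives identified, the product rule yields [x1 t * cos t] twice with
         opposite signs, and what is left is [g t]. *)
      + replace (Derive (fun s : R => x1 s) t) with (x2 t)
          by (symmetry; now apply is_derive_unique, Hdx1).
        replace (Derive (fun s : R => x s) t) with (x1 t)
          by (symmetry; now apply is_derive_unique, Hdx).
        replace (Derive (fun s : R => antideriv0 f s) (x t)) with (f (x t))
          by (symmetry; now apply is_derive_unique).
        ring. }
  unfold g in Hz.
  rewrite (RInt_minus (V := R_CompleteNormedModule) (fun t => e (c t) * sin t)
    (fun t => antideriv0 f (x (c t)) * cos t)) in Hz
    by now apply ex_RInt_everywhere_continuous.
  rewrite (RInt_ext (fun t => e t * sin t) (fun t => e (c t) * sin t)).
  - unfold minus, plus, opp in Hz; simpl in Hz; lra.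
  - rewrite Rmin_left, Rmax_right by lra; intros t Ht.
    unfold c; rewrite clamp_id by lra; reflexivity.
Qed.

Theorem mainTheorem2 (f e : R -> R) (Fpinf Fminf : R)
  (hf : forall s : R, continuous f s)
  (hFpinf : is_lim (antideriv0 f) p_infty (Finite Fpinf))
  (hFminf : is_lim (antideriv0 f) m_infty (Finite Fminf))
  (hF : forall s : R, Fminf < antideriv0 f s < Fpinf)
  (he : continuous_on I0PI e)
  (hsol : exists x : R -> R, is_solution f e x) :
  Rabs (RInt (fun t => e t * sin t) 0 PI) < Fpinf - Fminf.
Proof.
  destruct hsol as [x Hx].
  rewrite (RInt_forcing_sin f e x hf he Hx).
  (* The bounds [hF] hold at every real argument, hence along the clamped solution for every [t]. *)
  apply (Rabs_RInt_mult_cos_lt (fun t => antideriv0 f (x (clamp 0 PI t)))); [|intros t; apply hF].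
  intros t; apply (continuous_comp (fun s => x (clamp 0 PI s)) (antideriv0 f)).
  - destruct Hx as [[x1 [x2 [Hd _]]] _].
    apply continuous_clamp; [apply Rlt_le, PI_RGT_0|].
    exact (continuous_on_D_in _ _ _ Hd).
  - now apply continuous_antideriv0.
Qed.
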